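(* There exists an increasing function $f$ such that for any graph $G$, if the pathwidth of $G$ is at least $k$, then there exists a minor $G'$ of $G$ such that $b_v(G')\ge f(k)$.
   Context: Graphs are finite, simple and undirected. For a graph $G=(V,E)$ and $S\subseteq V$, the vertex boundary is $\phi(S,G)=\{v\in V-S:\exists u\in S\text{ such that }(u,v)\in E\}$. For an integer $i$ with $1\le i\le |V|$ let $b_v(i,G)=\min_{S\subseteq V,\ |S|=i}|\phi(S,G)|$, and let the vertex isoperimetric peak be $b_v(G)=\max_{1\le i\le |V|}b_v(i,G)$. Pathwidth and minors have their standard meaning. A path decomposition of $G$ is a sequence $X_1,\dots,X_m$ of subsets of $V$ whose union is $V$, such that every edge of $G$ has both endpoints in some $X_j$, and $X_a\cap X_c\subseteq X_b$ whenever $a\le b\le c$; its width is $\max_j|X_j|-1$, and the pathwidth of $G$ is the minimum width over all path decompositions of $G$. A minor of $G$ is a graph obtained from $G$ by a sequence of vertex deletions, edge deletions and edge contractions. *)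

(* Defs.v *)
From mathcomp Require Import all_boot all_order all_algebra.
From mathcomp Require Import boolp reals.

Set Implicit Arguments.
Unset Strict Implicit.
Unset Printing Implicit Defensive.

Record sgraph := SGraph {
  vertex :> finType;
  adj : rel vertex;
  adj_sym : symmetric adj;
  adj_irrefl : irreflexive adj }.

Definition boundary (G : sgraph) (S : {set G}) : {set G} :=
  [set v in ~: S | [exists u in S, adj u v]].

(* The starting value #|G| bounds every #|boundary S|, so for i <= #|G| this is
   the minimum over the (nonempty) family of sets of size i. *)
Definition viso_at (G : sgraph) (i : nat) : nat :=
  \big[minn/#|G|]_(S : {set G} | #|S| == i) #|boundary S|.

Definition viso_peak (G : sgraph) : nat :=
  \max_(1 <= i < #|G|.+1) viso_at G i.

Record path_decomposition (G : sgraph) (D : seq {set G}) : Prop :=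
  PathDecomposition {
    pd_cover : \bigcup_(X <- D) X = [set: G];
    pd_edge : forall u v : G, adj u v ->
      exists2 X, X \in D & (u \in X) && (v \in X);
    pd_interval : forall a b c, a <= b -> b <= c -> c < size D ->
      nth set0 D a :&: nth set0 D c \subset nth set0 D b }.

(* The truncated predecessor differs from "max - 1" only on the graph with no
   vertices, which gets width 0 instead of -1. *)
Definition width (G : sgraph) (D : seq {set G}) : nat :=
  (\max_(X <- D) #|X|).-1.

Lemma pathwidth_subproof (G : sgraph) :
  exists w, `[< exists2 D : seq {set G}, path_decomposition D & width D = w >].
Proof.
exists (width [:: [set: G]]); apply/asboolP; exists [:: [set: G]] => //.
split=> [|u v _|a b c ab bc]; first by rewrite big_seq1.
  by exists [set: G]; rewrite ?inE.
rewrite ltnS leqn0 => /eqP c0; move: bc ab.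
rewrite c0 leqn0 => /eqP ->; rewrite leqn0 => /eqP ->.
by rewrite setIid.
Qed.

Definition pathwidth (G : sgraph) : nat := ex_minn (pathwidth_subproof G).

Section Operations.
Variable G : sgraph.

Section DelVertex.
Variable v : G.
Let T : finType := {x : G | x != v}.
Let del_vertex_adj : rel T := fun x y => adj (val x) (val y).

Fact del_vertex_sym : symmetric del_vertex_adj.
Proof. by move=> x y; apply: adj_sym. Qed.

Fact del_vertex_irrefl : irreflexive del_vertex_adj.
Proof. by move=> x; apply: adj_irrefl. Qed.

Definition del_vertex := SGraph del_vertex_sym del_vertex_irrefl.
End DelVertex.

Section DelEdge.
Variables u v : G.
Let del_edge_adj : rel G := fun x y =>
  [&& adj x y, (x, y) != (u, v) & (x, y) != (v, u)].

Fact del_edge_sym : symmetric del_edge_adj.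
Proof.
move=> x y; rewrite /del_edge_adj adj_sym !xpair_eqE.
by rewrite [(x == u) && _]andbC [(x == v) && _]andbC; congr andb; rewrite andbC.
Qed.

Fact del_edge_irrefl : irreflexive del_edge_adj.
Proof. by move=> x; rewrite /del_edge_adj adj_irrefl. Qed.

Definition del_edge := SGraph del_edge_sym del_edge_irrefl.
End DelEdge.

(* The vertex v is removed and u, which plays the role of the merged vertex,
   inherits its neighbours; loops and multiple edges are discarded. *)
Section Contract.
Variables u v : G.
Let T : finType := {x : G | x != v}.
Let contract_adj : rel T := fun x y =>
  (x != y) && [|| adj (val x) (val y),
                  (val x == u) && adj v (val y) |
                  (val y == u) && adj v (val x)].

Fact contract_sym : symmetric contract_adj.
Proof.
move=> x y; rewrite /contract_adj eq_sym adj_sym; congr (_ && (_ || _)).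
exact: orbC.
Qed.

Fact contract_irrefl : irreflexive contract_adj.
Proof. by move=> x; rewrite /contract_adj eqxx. Qed.

Definition contract := SGraph contract_sym contract_irrefl.
End Contract.

End Operations.

(* [minor G H]: H is a minor of G. *)
Inductive minor (G : sgraph) : sgraph -> Prop :=
| minor_refl : minor G G
| minor_del_vertex (H : sgraph) (v : H) :
    minor G H -> minor G (del_vertex v)
| minor_del_edge (H : sgraph) (u v : H) :
    adj u v -> minor G H -> minor G (del_edge u v)
| minor_contract (H : sgraph) (u v : H) :
    adj u v -> minor G H -> minor G (contract u v).

(* Main.v *)
Require Import Defs.
From mathcomp Require Import all_boot all_order all_algebra zify.
From mathcomp Require Import boolp reals.
Import Order.TTheory GRing.Theory Num.Theory.
Set Implicit Arguments.
Unset Strict Implicit.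
Unset Printing Implicit Defensive.

(** Why the theorem holds.  A graph of pathwidth more than [N] contains every
    tree on [N] vertices as a minor, and a minor containing a spanning complete
    binary tree of large height has a large isoperimetric peak.

    Excluding a tree.  Sweep the graph one vertex at a time so that the set [X]
    of swept vertices always has at most [N] vertices with neighbours outside
    (its rim).  If the whole graph can be swept, the rims form a path
    decomposition of width at most [N] ([sweep_pathwidth]).  Otherwise the tree
    is grown node by node inside a swept set [X], each node being represented
    by a connected set that owns exactly one rim vertex ([saturated_grow]).
    [X] is kept maximal among the swept sets with no larger rim.  For a new
    node, take a neighbour [y] outside [X] of the rim vertex owned by the parent,
    and enlarge [y |: X] to a maximal swept set [Y] again.  No set between
    [y |: X] and [Y] has a smaller rim: one with the smallest rim would be swept,
    by submodularity ([sweep_restrict]), which contradicts the maximality of [X].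
    A Menger-type argument ([rooted_link]) then extends the connected sets so
    that they reach the rim of [Y].  Contracting them gives the minor
    ([branching_minor]).

    The peak of binary trees.  A vertex set with a small boundary differs in
    membership from its parent at few nodes only, so its size is a sum of few
    signed subtree sizes ([heap_card_digit_sum]).  A complete binary tree of
    height [h] has only [h] different subtree sizes, so for a fixed number of
    summands there are polynomially many such sums, fewer than the [2 ^ h - 1]
    possible sizes ([digit_sum_gap]).  At a size that is not such a sum, every
    set has a large boundary. *)

(** * Rims, sweeps and pathwidth *)

Section Rim.
Variable V : finType.
Implicit Types (e : rel V) (X Y Z : {set V}).

(** The inner boundary.  The relation is not assumed symmetric, because the
    linking argument deletes single arcs. *)
Definition rim e X := [set x in X | [exists y, (y \notin X) && e x y]].

Lemma rimP e X x :
  reflect (x \in X /\ exists2 y, y \notin X & e x y) (x \in rim e X).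
Proof.
rewrite inE; apply: (iffP andP) => -[xX].
  by case/existsP=> y /andP[yX xy]; split=> //; exists y.
by case=> y yX xy; split=> //; apply/existsP; exists y; rewrite yX.
Qed.

Lemma rim0 e : rim e set0 = set0.
Proof. by apply/setP => x; rewrite !inE. Qed.

Lemma rim_add e X y : rim e (y |: X) \subset y |: rim e X.
Proof.
apply/subsetP => x /rimP[]; rewrite !inE => /orP[->//|xX] [z].
rewrite !inE negb_or => /andP[_ zX] xz; apply/orP; right; rewrite xX /=.
by apply/existsP; exists z; rewrite zX.
Qed.

(** The complement of the rim in [X] is the set of points all of whose
    successors lie in [X]; this core is monotone and commutes with
    intersections, hence its size is supermodular. *)
Lemma rim_submod e X Y :
  #|rim e (X :&: Y)| + #|rim e (X :|: Y)| <= #|rim e X| + #|rim e Y|.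
Proof.
have sub Z : rim e Z \subset Z by apply/subsetP => x /rimP[].
pose core Z := Z :\: rim e Z.
have rimE Z : #|rim e Z| + #|core Z| = #|Z|.
  by rewrite -(cardsID (rim e Z) Z) (setIidPr (sub Z)).
have coreP Z x : x \in core Z = (x \in Z) && [forall y, e x y ==> (y \in Z)].
  rewrite !inE; case: (x \in Z) => //=; rewrite andbT negb_exists.
  by apply: eq_forallb => y; rewrite negb_and negbK orbC implybE.
have capE : core (X :&: Y) = core X :&: core Y.
  apply/setP => x; rewrite in_setI !coreP inE.
  apply/idP/idP => [/andP[/andP[-> ->]] /forallP h|].
    by apply/andP; split; apply/forallP => y; have:= h y;
       case: (e x y) => //=; rewrite inE => /andP[].
  case/andP=> /andP[-> /forallP h] /andP[-> /forallP k].
  apply/forallP => y; have:= h y; have:= k y.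
  by case: (e x y) => //=; rewrite inE => -> ->.
have cupS : core X :|: core Y \subset core (X :|: Y).
  apply/subsetP => x; rewrite in_setU !coreP inE.
  case/orP=> /andP[-> /forallP h]; rewrite ?orbT /=; apply/forallP => y;
    by have:= h y; case: (e x y) => //=; rewrite inE => ->; rewrite ?orbT.
have := subset_leq_card cupS; have := cardsUI X Y.
have := cardsUI (core X) (core Y); rewrite -capE.
move: (rimE X) (rimE Y) (rimE (X :&: Y)) (rimE (X :|: Y)).
lia.
Qed.

(** The initial segments of a linear layout in which every initial segment has
    a rim of size at most [n]: the vertex-separation form of pathwidth. *)
Inductive sweep e n : {set V} -> Prop :=
| sweep0 : sweep e n set0
| sweepU X y : sweep e n X -> #|rim e (y |: X)| <= n -> sweep e n (y |: X).

(** Intersecting the stages of a sweep of [Y] with [Z] gives a sweep of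
    [Y :&: Z]: by submodularity the rim of [X :&: Z] can exceed that of [X] only
    if [Z :|: X] has a smaller rim than [Z], which is excluded. *)
Lemma sweep_restrict e n Y Z : sweep e n Y ->
  (forall Z', Z \subset Z' -> Z' \subset Z :|: Y -> #|rim e Z| <= #|rim e Z'|) ->
  sweep e n (Y :&: Z).
Proof.
elim=> [_|X y swX IH le_n tight]; first by rewrite set0I; apply: sweep0.
have swXZ : sweep e n (X :&: Z).
  apply: IH => Z' ZZ' Z'sub; apply: tight => //.
  by apply: subset_trans Z'sub _; rewrite setUS // subsetUr.
have [yZ|yZ] := boolP (y \in Z); last first.
  rewrite setIUl (_ : [set y] :&: Z = set0) ?set0U //.
  by apply/setP=> x; rewrite !inE; case: eqP => // ->; rewrite (negbTE yZ).
have capE : (y |: X) :&: Z = y |: (X :&: Z).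
  by rewrite setIUl (setIidPl _) // sub1set.
rewrite capE; apply: sweepU => //; rewrite -capE.
have := rim_submod e (y |: X) Z.
have := tight ((y |: X) :|: Z) (subsetUr _ _).
rewrite [Z :|: _]setUC subxx => /(_ isT).
lia.
Qed.

Lemma sweep_seq e n X : sweep e n X -> exists s : seq V,
  [/\ uniq s, X = [set x in s] &
      forall j, #|rim e [set x in take j s]| <= n].
Proof.
elim=> [|{}X y _ [s [us sX rims]] le_n].
  have e0 : [set x in [::]] = set0 :> {set V} by apply/setP=> x; rewrite !inE.
  by exists [::]; split=> [||j] //; rewrite /= e0 ?rim0 ?cards0.
have [yX|yX] := boolP (y \in X).
  by exists s; split=> //; rewrite (setUidPr _) // sub1set.
exists (rcons s y); split=> [||j].
- by rewrite rcons_uniq us andbT; move: yX; rewrite sX inE.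
- by apply/setP=> x; rewrite sX !inE mem_rcons inE.
rewrite -cats1 take_cat; case: ltnP => [_|lej]; first exact: rims.
case: (j - size s) => [|k] /=.
  by rewrite cats0 -[s]take_size; apply: rims.
rewrite (_ : [set x in _] = y |: X) //.
by apply/setP=> x; rewrite sX !inE mem_cat inE orbC.
Qed.

End Rim.

Lemma pathwidth_le (G : sgraph) (D : seq {set G}) :
  path_decomposition D -> pathwidth G <= width D.
Proof.
move=> pdD; rewrite /pathwidth; case: ex_minnP => m _; apply.
by apply/asboolP; exists D.
Qed.

(** The bag at time [j] consists of the [j]-th vertex and the rim of the vertices
    before it.  A vertex thus stays in the bags from its own time until the
    time of its last neighbour. *)
Lemma sweep_pathwidth (G : sgraph) n :
  sweep (@adj G) n [set: G] -> pathwidth G <= n.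
Proof.
case/sweep_seq => s [us sT rims].
have sG (x : G) : x \in s by move/setP: sT => /(_ x); rewrite !inE.
have mem_takeE j (x : G) : (x \in [set y in take j s]) = (index x s < j).
  by rewrite inE in_take.
pose bag j := [set x | index x s == j] :|: rim (@adj G) [set x in take j s].
pose D := mkseq bag (size s).
have bagP j (x : G) : reflect (index x s = j \/
    index x s < j /\ exists2 y, j <= index y s & adj x y) (x \in bag j).
  rewrite 2!inE; apply: (iffP orP) => -[].
  - by move/eqP; left.
  - case/rimP; rewrite mem_takeE => xj [y]; rewrite mem_takeE -leqNgt => yj xy.
    by right; split=> //; exists y.
  - by move->; left.
  case=> xj [y yj xy]; right; apply/rimP; rewrite mem_takeE; split=> //.
  by exists y; rewrite // mem_takeE -leqNgt.
have bagD j : j < size s -> bag j \in D by move=> js; apply/mapP; exists j; rewrite ?mem_iota.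
have sz : size D = size s by rewrite size_mkseq.
apply: leq_trans (pathwidth_le (D := D) _) _.
  split=> [|u v uv|a b c ab bc].
  - apply/eqP; rewrite -subTset; apply/subsetP => x _.
    have xs : index x s < size s by rewrite index_mem.
    rewrite (big_rem (bag (index x s))) ?bagD //= in_setU.
    by apply/orP; left; apply/bagP; left.
  - wlog ltuv : u v uv / index u s < index v s.
      have [lt|lt|eq] := ltngtP (index u s) (index v s) => H.
      + exact: (H u v).
      + by case: (H v u) => //; rewrite ?[adj v u]adj_sym // => B BD; rewrite andbC; exists B.
      by move: uv; rewrite -(nth_index u (sG u)) eq nth_index // adj_irrefl.
    exists (bag (index v s)); first by rewrite bagD // index_mem.
    apply/andP; split; apply/bagP; last by left.
    by right; split=> //; exists v.
  - rewrite sz => cs; have bs := leq_ltn_trans bc cs; have as_ := leq_ltn_trans ab bs.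
    rewrite !nth_mkseq //; apply/subsetP => x /setIP[/bagP xa /bagP xc].
    apply/bagP; have [->|xb] := eqVneq (index x s) b; first by left.
    have xltb : index x s < b by case: xa => [xa|[]]; move: xb; lia.
    right; split=> //.
    case: xc => [xc|[_ [y cy xy]]]; last by exists y => //; apply: leq_trans bc cy.
    by move: xltb; rewrite xc ltnNge bc.
rewrite /width -subn1 leq_subLR add1n.
rewrite big_seq; elim/big_ind: _ => // [p q pn qn|B /mapP[j _ ->]].
  by rewrite geq_max pn.
apply: leq_trans (leq_card_setU _ _) _; rewrite -[n.+1]add1n leq_add //.
by apply/card_le1_eqP => x y; rewrite !inE => /eqP xj /eqP yj;
   rewrite -(nth_index x (sG x)) -(nth_index x (sG y)) xj yj.
Qed.

(** * Linking coloured classes to a larger set *)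

Section Colouring.
Variables (G : sgraph) (T : finType).
Implicit Types (e : rel G) (X Y Z A : {set G}) (c : G -> option T) (r : T -> G).
Implicit Types (I : {set T}) (i j : T).

(** Connectedness as the absence of an edgeless cut, which passes to quotients
    without any handling of paths. *)
Definition class_connected c i := forall A,
  (exists2 x, c x = Some i & x \in A) -> (exists2 y, c y = Some i & y \notin A) ->
  exists x y, [/\ c x = Some i, c y = Some i, x \in A, y \notin A & adj x y].

Definition classes_touch c i j := exists x y, [/\ c x = Some i, c y = Some j & adj x y].

Definition extends c c' := forall x i, c x = Some i -> c' x = Some i.

Definition paint c y i : G -> option T := fun x => if x == y then Some i else c x.

(** A partial minor model with a root of each branch set on the rim, from which
    the branch set can be extended.  Disjointness is built into the colouring,
    and only the rim depends on [e]: connectedness refers to the edges of [G]. *)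
Record rooted e X I c r : Prop := Rooted {
  rooted_col : forall x i, c x = Some i -> x \in X /\ i \in I;
  rooted_root : {in I, forall i, c (r i) = Some i};
  rooted_rim : {in I, forall i, r i \in rim e X};
  rooted_conn : {in I, forall i, class_connected c i} }.

Lemma extends_trans c c' c'' : extends c c' -> extends c' c'' -> extends c c''.
Proof. by move=> h k x i /h /k. Qed.

Lemma touch_extends c c' i j :
  extends c c' -> classes_touch c i j -> classes_touch c' i j.
Proof. by move=> ext [x [y [/ext cx /ext cy xy]]]; exists x, y. Qed.

Lemma paint_extends c y i : c y = None -> extends c (paint c y i).
Proof. by move=> cy x j cx; rewrite /paint; case: eqP => // xy; rewrite xy cy in cx. Qed.

Lemma paint_connected c x y i j : c y = None -> c x = Some i -> adj x y ->
  class_connected c j -> class_connected (paint c y i) j.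
Proof.
move=> cy cx xy conn A; rewrite /paint => -[u cu uA] [v cv vA].
have old a : c a = Some j -> (if a == y then Some i else c a) = Some j.
  by case: eqP => // ->; rewrite cy.
have cut u' v' : c u' = Some j -> u' \in A -> c v' = Some j -> v' \notin A ->
    exists a b, [/\ (if a == y then Some i else c a) = Some j,
      (if b == y then Some i else c b) = Some j, a \in A, b \notin A & adj a b].
  move=> cu' u'A cv' v'A; case: (conn A) => [||a [b [ca cb aA bA ab]]].
  - by exists u'. - by exists v'.
  by exists a, b; split=> //; apply: old.
have [eij|nij] := eqVneq i j; last first.
  move: cu cv; case: eqP => [_ [/eqP]|_ cu]; first by rewrite (negbTE nij).
  case: eqP => [_ [/eqP]|_ cv]; first by rewrite (negbTE nij).
  exact: (cut u v).
subst j.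
have xNy : x != y by apply/eqP => exy; rewrite exy cy in cx.
have [xA|xA] := boolP (x \in A); have [yA|yA] := boolP (y \in A).
- apply: (cut x v) => //; move: cv; case: eqP => // vy.
  by rewrite vy yA in vA.
- by exists x, y; rewrite eqxx (negbTE xNy).
- by exists y, x; rewrite eqxx (negbTE xNy) adj_sym.
apply: (cut u x) => //; move: cu; case: eqP => // uy.
by rewrite -uy uA in yA.
Qed.

Lemma rooted_inj e X I c r : rooted e X I c r -> {in I &, injective r}.
Proof.
by move=> rt i j iI jI eq; have:= rooted_root rt iI; rewrite eq (rooted_root rt jI) => -[].
Qed.

(** The roots are distinct rim points, so when there are as many indices as rim
    points they are all of them. *)
Lemma rooted_surj e X I c r x : rooted e X I c r -> #|rim e X| = #|I| ->
  x \in rim e X -> exists2 i, i \in I & x = r i.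
Proof.
move=> rt eqI xX; apply/imsetP; suff -> : r @: I = rim e X by [].
apply/eqP; rewrite eqEcard card_in_imset ?eqI ?leqnn ?andbT; last exact: rooted_inj rt.
by apply/subsetP => _ /imsetP[i iI ->]; apply: rooted_rim rt _ iI.
Qed.

(** Menger's theorem in the form needed here: if no set between [X] and [Y] has
    a smaller rim than [X], the classes extend to classes that are rooted in the
    rim of [Y].  Induction on the number of arcs plus the number of vertices
    between [X] and [Y].  If some root is not on the rim of [Y], all its
    neighbours are in [Y].  If it has only one neighbour outside [X], that
    neighbour joins the class and becomes its root.  Otherwise, either some
    intermediate set has a rim of size exactly [#|I|], and it splits the problem
    into two smaller ones, or one of the arcs out of the root can be deleted
    without making any rim smaller than [#|I|]. *)
Lemma rooted_link e X Y I c r : subrel e (@adj G) -> X \subset Y ->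
  rooted e X I c r -> #|rim e X| = #|I| ->
  (forall Z, X \subset Z -> Z \subset Y -> #|I| <= #|rim e Z|) ->
  exists c' r', rooted e Y I c' r' /\ extends c c'.
Proof.
have [m] := ubnP (#|[set p | e p.1 p.2]| + #|Y :\: X|).
elim: m e X Y c r => // m IH e X Y c r; rewrite ltnS => lem eadj XY rt eqI tight.
have [rimS|] := boolP (rim e X \subset rim e Y).
  exists c, r; split=> //; split; try by case: rt.
    by move=> x i /(rooted_col rt)[xX iI]; split=> //; apply: (subsetP XY).
  by move=> i iI; apply: (subsetP rimS); apply: rooted_rim rt _ iI.
case/subsetPn => x xrX xrY; have [xX [y yX exy]] := rimP _ _ _ xrX.
have inY z : e x z -> z \in Y.
  apply: contraTT => zY; move: xrY; apply: contraNN => exz.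
  by apply/rimP; split; [apply: (subsetP XY)|exists z].
have yY := inY y exy.
have [i iI xi] := rooted_surj rt eqI xrX.
have ci : c x = Some i by rewrite xi (rooted_root rt iI).
have cy : c y = None.
  by case cyE: (c y) => [j|//]; case: (rooted_col rt cyE); rewrite (negbTE yX).
have yXY : y |: X \subset Y by rewrite subUset sub1set yY.
have [/existsP[z /and3P[zy zX exz]]|/existsPn uniq_y] :=
    boolP [exists z, [&& z != y, z \notin X & e x z]]; last first.
  have rim_sub : rim e (y |: X) \subset y |: (rim e X :\ x).
    apply/subsetP => u uX; have := subsetP (rim_add e X y) u uX.
    rewrite !in_setU1 in_setD1; case: (u == y) => //= urX; rewrite urX andbT.
    apply/eqP => ux.
    case/rimP: uX; rewrite ux => _ [z]; rewrite !inE negb_or => /andP[zy zX] xz.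
    by have:= uniq_y z; rewrite zy zX xz.
  have rimE : rim e (y |: X) = y |: (rim e X :\ x).
    apply/eqP; rewrite eqEcard rim_sub /=.
    apply: leq_trans (tight _ (subsetUr _ _) yXY).
    rewrite cardsU1 -eqI (cardsD1 x (rim e X)) xrX leq_add2r.
    by case: (_ \notin _).
  have lt : #|[set p | e p.1 p.2]| + #|Y :\: (y |: X)| < m.
    apply: leq_trans lem; rewrite -addnS leq_add2l.
    rewrite [X in _ < X](cardsD1 y) inE yX yY /= add1n ltnS subset_leq_card //.
    by apply/subsetP => u; rewrite !inE negb_or andbA.
  have [|||c' [r' [rt' ext]]] :=
    IH e (y |: X) Y (paint c y i) (fun j => if j == i then y else r j) lt eadj yXY.
  - split=> [u j|j jI|j jI|j jI].
    + rewrite /paint !inE; case: eqP => [-> [<-]//|_ /(rooted_col rt)[-> ->]//].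
    + rewrite /paint; case: (eqVneq j i) => [->|_]; first by rewrite eqxx.
      have cj := rooted_root rt jI; case: eqP => // rjy.
      by rewrite rjy cy in cj.
    + rewrite rimE; apply/setU1P; case: (eqVneq j i) => [|ji]; first by left.
      right; rewrite in_setD1 (rooted_rim rt jI) andbT.
      apply: contraNneq ji => rjx; apply/eqP; apply: (rooted_inj rt) => //.
      by rewrite rjx.
    + apply: paint_connected (rooted_conn rt jI) => //; first exact: ci.
      exact: eadj.
  - rewrite rimE cardsU1 -eqI (cardsD1 x (rim e X)) xrX; congr (_ + _).
    by rewrite !inE (negbTE yX) andbF.
  - by move=> Z XZ; apply: tight; apply: subset_trans XZ; apply: subsetUr.
  exists c', r'; split=> //; apply: extends_trans ext; exact: paint_extends.
have [/existsP[Z /and5P[XZ ZY nZX nZY /eqP eqZ]]|/existsPn loose] :=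
    boolP [exists Z : {set G},
      [&& X \subset Z, Z \subset Y, Z != X, Z != Y & #|rim e Z| == #|I|]].
  have XpZ : X \proper Z by rewrite properEneq eq_sym nZX.
  have ZpY : Z \proper Y by rewrite properEneq nZY.
  have lt1 : #|[set p | e p.1 p.2]| + #|Z :\: X| < m.
    apply: leq_trans lem; rewrite ltn_add2l !cardsDS //.
    by apply: ltn_sub2r (proper_card ZpY); apply: proper_card (proper_sub_trans XpZ ZY).
  have lt2 : #|[set p | e p.1 p.2]| + #|Y :\: Z| < m.
    apply: leq_trans lem; rewrite ltn_add2l !cardsDS //.
    by apply: ltn_sub2l (proper_card XpZ); apply: proper_card (proper_sub_trans XpZ ZY).
  have [|c1 [r1 [rt1 ext1]]] := IH e X Z c r lt1 eadj XZ rt eqI.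
    by move=> Z' XZ' Z'Z; apply: tight => //; apply: subset_trans ZY.
  have [|c2 [r2 [rt2 ext2]]] := IH e Z Y c1 r1 lt2 eadj ZY rt1 eqZ.
    by move=> Z' ZZ'; apply: tight => //; apply: subset_trans ZZ'.
  by exists c2, r2; split=> //; apply: extends_trans ext2.
(* [x] keeps its arc to [z], so deleting the arc to [y] preserves the rim of [X];
   the rim of [Y] is preserved because [y] is in [Y]. *)
pose e' : rel G := fun u v => e u v && ((u, v) != (x, y)).
have e'S : subrel e' e by move=> u v /andP[].
have rim_e' Z : rim e' Z \subset rim e Z.
  apply/subsetP => u /rimP[uZ [v vZ /e'S uv]].
  by apply/rimP; split=> //; exists v.
have rim_e'D Z : rim e Z :\ x \subset rim e' Z.
  apply/subsetP => u /setD1P[ux /rimP[uZ [v vZ uv]]].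
  by apply/rimP; split=> //; exists v => //; rewrite /e' uv xpair_eqE (negbTE ux).
have rim_e'X : rim e' X = rim e X.
  apply/eqP; rewrite eqEsubset rim_e'; apply/subsetP => u uX.
  have [->|ux] := eqVneq u x; last by apply: (subsetP (rim_e'D X)); rewrite in_setD1 ux.
  by apply/rimP; split=> //; exists z => //; rewrite /e' exz xpair_eqE (negbTE zy) andbF.
have lt : #|[set p | e' p.1 p.2]| + #|Y :\: X| < m.
  apply: leq_trans lem; rewrite ltn_add2r.
  apply: proper_card; apply/properP; split.
    by apply/subsetP => -[u v]; rewrite !inE => /e'S.
  by exists (x, y); rewrite !inE // /e' /= eqxx andbF.
have e'adj : subrel e' (@adj G) by move=> u v /e'S /eadj.
have [|||c' [r' [rt' ext]]] := IH e' X Y c r lt e'adj XY.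
- by case: rt => *; split=> //; rewrite rim_e'X.
- by rewrite rim_e'X.
- move=> Z XZ ZY.
  have [->|nZX] := eqVneq Z X; first by rewrite rim_e'X eqI.
  have [->|nZY] := eqVneq Z Y.
    apply: leq_trans (tight Y XY (subxx _)) _.
    apply: leq_trans (subset_leq_card (rim_e'D Y)).
    by rewrite (cardsD1 x (rim e Y)) (negbTE xrY).
  have := tight Z XZ ZY; rewrite leq_eqVlt => /orP[eqZ|ltZ].
    by have := loose Z; rewrite XZ ZY nZX nZY eq_sym eqZ.
  apply: leq_trans (subset_leq_card (rim_e'D Z)).
  by move: ltZ; rewrite (cardsD1 x (rim e Z)); case: (_ \in _) => // /ltnW.
exists c', r'; split=> //; case: rt' => ? ? rimr ?; split=> // j jI.
by apply: (subsetP (rim_e' Y)); apply: rimr.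
Qed.

End Colouring.

(** * Growing a tree in a graph of large pathwidth *)

Section Growth.
Variables (G : sgraph) (T : finType) (n : nat).
Implicit Types (X Y Z : {set G}) (c : G -> option T) (r : T -> G) (I : {set T}).
Local Notation rim := (rim (@adj G)).
Local Notation sweep := (sweep (@adj G) n).
Local Notation rooted := (rooted (@adj G)).

(** The maximality that drives the growth: when the rim of [X] has exactly [p]
    vertices, a vertex added to [X] must enlarge the rim. *)
Definition saturated p X :=
  [/\ sweep X, #|rim X| <= p & forall Y, sweep Y -> X \proper Y -> p < #|rim Y|].

Lemma saturated_exists p X : sweep X -> #|rim X| <= p ->
  exists2 Y : {set G}, X \subset Y & saturated p Y.
Proof.
move=> swX leX; pose P (Y : {set G}) := `[< sweep Y >] && (#|rim Y| <= p).
have [|Y maxY XY] := @maxset_exists _ P X; first by apply/andP; split=> //; apply/asboolP.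
have [/andP[/asboolP swY leY] max] := maxsetP maxY.
exists Y => //; split=> // Z swZ YZ; rewrite ltnNge; apply/negP => leZ.
have PZ : P Z by apply/andP; split=> //; apply/asboolP.
by move: (YZ); rewrite (max Z PZ (proper_sub YZ)) properxx.
Qed.

(** One growth step.  Adding an outside neighbour [y] of the root of [s] makes the
    rim grow by exactly one, by saturation of [X].  The class of the new index
    [t] is [y] alone; then everything is linked to a saturated superset.  For
    the first node of the tree there is no parent, and any outside vertex
    serves. *)
Lemma saturated_grow I t X c r : ~ sweep setT -> #|I| < n -> t \notin I ->
  saturated #|I| X -> #|rim X| = #|I| -> rooted X I c r ->
  forall s, I = set0 \/ s \in I -> exists X' c' r',
    [/\ saturated #|t |: I| X', #|rim X'| = #|t |: I|, rooted X' (t |: I) c' r',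
        extends c c' & s \in I -> classes_touch c' t s].
Proof.
move=> nswT ltIn tI [swX _ satX] eqX rt s sI.
have [y yX ys] : exists2 y, y \notin X & (s \in I -> adj y (r s)).
  have [sIn|sNI] := boolP (s \in I).
    by have [_ [y yX ry]] := rimP _ _ _ (rooted_rim rt sIn); exists y => //; rewrite adj_sym.
  have [|/subsetPn[y _ yX]] := boolP ([set: G] \subset X); last by exists y.
  by rewrite subTset => /eqP XT; case: nswT; rewrite -XT.
have cy : c y = None.
  by case cyE: (c y) => [j|//]; case: (rooted_col rt cyE); rewrite (negbTE yX).
have rimS := rim_add (@adj G) X y.
have leI : #|rim (y |: X)| <= #|t |: I|.
  apply: leq_trans (subset_leq_card rimS) _.
  by rewrite !cardsU1 eqX tI leq_add2r; case: (_ \notin _).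
have swy : sweep (y |: X).
  by apply: sweepU => //; apply: leq_trans leI _; rewrite cardsU1 tI.
have ltX : X \proper y |: X by rewrite properE subsetUr subUset sub1set (negbTE yX).
have card_tI : #|t |: I| = #|I|.+1 by rewrite cardsU1 tI.
have rimE : rim (y |: X) = y |: rim X.
  apply/eqP; rewrite eqEcard rimS; apply: leq_trans (satX _ swy ltX).
  by rewrite cardsU1 eqX; case: (_ \notin _).
have card_y : #|rim (y |: X)| = #|t |: I|.
  by apply/eqP; rewrite eqn_leq leI card_tI satX.
have [Y yXY satY] := saturated_exists swy leI.
(* Among the sets between [y |: X] and [Y], one with the smallest rim is swept;
   a rim of at most [#|I|] vertices would contradict the saturation of [X]. *)
have tightY Z : y |: X \subset Z -> Z \subset Y -> #|t |: I| <= #|rim Z|.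
  move=> yXZ ZY; rewrite leqNgt; apply/negP => ltZ.
  pose P (Z' : {set G}) := (y |: X \subset Z') && (Z' \subset Y).
  have PZ : P Z by rewrite /P yXZ.
  case: (@arg_minnP _ Z P (fun Z' => #|rim Z'|) PZ) => Z' /andP[yXZ' Z'Y] minZ'.
  have swZ' : sweep Z'.
    rewrite -(setIidPr Z'Y); apply: sweep_restrict => [|W Z'W]; first by case: satY.
    rewrite (setUidPr Z'Y) => WY; apply: minZ'.
    by rewrite /P WY andbT; apply: subset_trans Z'W.
  have := satX Z' swZ' (proper_sub_trans ltX yXZ').
  by have := minZ' Z PZ; move: ltZ; rewrite card_tI; lia.
pose c1 := paint c y t; pose r1 := fun i => if i == t then y else r i.
have rt1 : rooted (y |: X) (t |: I) c1 r1.
  split=> [x i|i iI|i iI|i iI].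
  - rewrite /c1 /paint !in_setU1; case: (x == y) => [[<-]|]; first by rewrite eqxx.
    by move/(rooted_col rt) => -[-> ->]; rewrite !orbT.
  - rewrite /c1 /paint /r1; case: (eqVneq i t) iI => [-> _|it]; first by rewrite eqxx.
    rewrite in_setU1 (negbTE it) /= => iI; have ci := rooted_root rt iI.
    by case: eqP => // ry; rewrite ry cy in ci.
  - rewrite rimE /r1 in_setU1; case: (eqVneq i t) iI => [_ _|it]; first by rewrite eqxx.
    by rewrite in_setU1 (negbTE it) /= => /(rooted_rim rt) ->; rewrite orbT.
  case: (eqVneq i t) iI => [-> _|it].
    move=> A [x cx xA] [x' cx' x'A]; have old z : c1 z = Some t -> z = y.
      rewrite /c1 /paint; case: eqP => // _ /(rooted_col rt)[_].
      by rewrite (negbTE tI).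
    by rewrite (old _ cx) in xA; rewrite (old _ cx') xA in x'A.
  rewrite in_setU1 (negbTE it) /= => iI A.
  have same z : (c1 z = Some i) <-> (c z = Some i).
    rewrite /c1 /paint; case: eqP => [->|//]; rewrite cy; split=> // -[ti].
    by rewrite ti eqxx in it.
  case=> x /same cx xA [x' /same cx' x'A].
  case: (rooted_conn rt iI (A := A)); [by exists x|by exists x'|].
  by move=> u [v [cu cv uA vA uv]]; exists u, v; split=> //; apply/same.
have [//|c' [r' [rt' ext']]] := rooted_link _ yXY rt1 card_y tightY.
exists Y, c', r'; split=> //.
- by apply/eqP; rewrite eqn_leq tightY // andbT; case: satY.
- by apply: extends_trans ext'; apply: paint_extends.
move=> sIn; apply: touch_extends ext' _; exists y, (r s); split; last exact: ys.
- by rewrite /c1 /paint eqxx.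
- by apply: paint_extends => //; apply: rooted_root rt _ sIn.
Qed.

End Growth.

(** The nodes are added in the order of their indices, so a parent is present
    before its children. *)
Lemma tree_model (G : sgraph) N (par : 'I_N -> 'I_N) :
  (forall i : 'I_N, 0 < i -> par i < i) -> N < pathwidth G ->
  exists c : G -> option 'I_N,
    [/\ forall i, exists x, c x = Some i, forall i, class_connected c i &
        forall i : 'I_N, 0 < i -> classes_touch c i (par i)].
Proof.
move=> par_lt pwN.
have nsw : ~ sweep (@adj G) N [set: G].
  by move/sweep_pathwidth; rewrite leqNgt pwN.
pose I p := [set i : 'I_N | i < p].
have cardI p : p <= N -> #|I p| = p.
  by move=> pN; rewrite -sum1dep_card (big_ord_narrow pN) sum1_card card_ord.
suff /(_ N (leqnn N)) [X [c [r [_ _ rt touch]]]] : forall p, p <= N -> exists X c r,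
    [/\ saturated N #|I p| X, #|rim (@adj G) X| = #|I p|, rooted (@adj G) X (I p) c r &
        forall i : 'I_N, 0 < i < p -> classes_touch c i (par i)].
  have inI i : i \in I N by rewrite inE ltn_ord.
  exists c; split=> [i|i|i i0]; last by apply: touch; rewrite i0 ltn_ord.
    by exists (r i); apply: (rooted_root rt).
  exact: (rooted_conn rt).
elim=> [_|p IH pN].
  have I0 : I 0 = set0 by apply/setP=> i; rewrite !inE.
  have [||X _ satX] := @saturated_exists G N 0 set0; rewrite ?rim0 ?cards0 //.
    exact: sweep0.
  have [x0 _] : exists x0, x0 \in [set: G].
    by apply/set0Pn; apply/eqP => G0; apply: nsw; rewrite G0; apply: sweep0.
  exists X, (fun=> None), (fun=> x0); rewrite I0; split=> //.
  - by case: satX; rewrite leqn0 => _ /eqP.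
  - by split=> // i; rewrite inE.
  - by move=> i; rewrite ltn0 andbF.
have [X [c [r [satX eqX rt touch]]]] := IH (ltnW pN).
pose t := Ordinal pN.
have IS : I p.+1 = t |: I p.
  by apply/setP=> i; rewrite !inE -val_eqE /= ltnS leq_eqVlt.
have [|||X' [c' [r' [satX' eqX' rt' ext tch]]]] :=
    saturated_grow (t := t) (s := par t) nsw _ _ satX eqX rt.
- by rewrite cardI // ltnW.
- by rewrite inE ltnn.
- case: (posnP p) => [p0|p0]; [left|right; rewrite inE; exact: par_lt].
  by apply/setP=> i; rewrite !inE p0.
rewrite IS; exists X', c', r'; split=> // i /andP[i0]; rewrite ltnS leq_eqVlt.
case/orP=> [/eqP ip|ip]; last by apply: touch_extends ext _; apply: touch; rewrite i0.
have -> : i = t by apply: val_inj.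
by apply: tch; rewrite inE; apply: (par_lt t); rewrite /= -ip.
Qed.

(** * From connected classes to a minor *)

Section Minor.
Variables (T : finType) (t : rel T).

(** The branch sets of a minor model of [t]; vertices may stay uncoloured. *)
Definition branching (G : sgraph) (c : G -> option T) :=
  [/\ forall i, exists x, c x = Some i, forall i, class_connected c i &
      forall i j, t i j -> classes_touch c i j].

(** A common form for vertex deletions and contractions: [q] is the partial
    quotient map, undefined on deleted vertices. *)
Lemma branching_image (H K : sgraph) (c : H -> option T) (d : K -> option T)
    (q : H -> option K) :
  irreflexive t ->
  (forall x i, c x = Some i -> exists2 y, q x = Some y & d y = Some i) ->
  (forall y i, d y = Some i -> exists2 x, q x = Some y & c x = Some i) ->
  (forall x x' y y', q x = Some y -> q x' = Some y' -> y != y' -> adj x x' -> adj y y') ->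
  branching c -> branching d.
Proof.
move=> tirr push pull qadj [surj conn touch]; split=> [i|i|i j tij].
- by have [x /push[y _ dy]] := surj i; exists y.
- move=> A [y dy yA] [y' dy' y'A].
  pose B := [set x | if q x is Some z then z \in A else false].
  have [x qx cx] := pull y i dy; have [x' qx' cx'] := pull y' i dy'.
  have [||u [v [cu cv]]] := conn i B.
  + by exists x; rewrite // inE qx.
  + by exists x'; rewrite // inE qx'.
  have [a qu da] := push u i cu; have [b qv db] := push v i cv.
  rewrite !inE qu qv => aA bA uv; exists a, b; split=> //.
  by apply: qadj qu qv _ uv; apply: contraNneq bA => <-.
have [x [x' [/push[y qx dy] /push[y' qx' dy'] xx']]] := touch i j tij.
exists y, y'; split=> //; apply: qadj qx qx' _ xx'; apply/eqP => eyy.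
by move: dy' tij; rewrite -eyy dy => -[->]; rewrite tirr.
Qed.

(** Delete uncoloured vertices and contract monochromatic edges as long as there
    are any.  When none is left, the connected classes are singletons.  Edges
    outside [t] are kept, as they can only enlarge boundaries. *)
Lemma branching_minor (G : sgraph) (c : G -> option T) :
  irreflexive t -> branching c ->
  exists (H : sgraph) (h : T -> H),
    [/\ minor G H, bijective h & forall i j, t i j -> adj (h i) (h j)].
Proof.
move=> tirr.
suff step m (H : sgraph) (d : H -> option T) : #|H| < m -> minor G H -> branching d ->
    exists (H : sgraph) (h : T -> H),
    [/\ minor G H, bijective h & forall i j, t i j -> adj (h i) (h j)].
  by move=> brc; apply: (step #|G|.+1 G c) => //; apply: minor_refl.
elim: m H d => // m IH H d; rewrite ltnS => leHm GH brd.
have small (v : H) : #|del_vertex v| < m.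
  by apply: leq_trans leHm;
     rewrite (card_sig (fun x => x != v)) [X in _ < X](cardD1 v) inE add1n ltnS;
     apply: subset_leq_card; apply/subsetP => x; rewrite !inE => ->.
have [/existsP[v /eqP dv]|/existsPn coloured] := boolP [exists v, d v == None].
  apply: (IH (del_vertex v) (fun x => d (val x))) => //; first exact: minor_del_vertex.
  apply: (@branching_image H (del_vertex v) d _ insub tirr _ _ _ brd).
  - move=> x i dx; have xv : x != v by apply: contra_eq_neq dx => ->; rewrite dv.
    by exists (Sub x xv); rewrite ?insubT ?SubK.
  - by move=> y i dy; exists (val y); rewrite ?valK.
  move=> x x' y y'; case: insubP => // u _ ux [<-]; case: insubP => // u' _ ux' [<-] _.
  by rewrite -ux -ux'.
have [/existsP[u /existsP[v /andP[uv /eqP duv]]]|nouv] :=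
    boolP [exists u, exists v, adj u v && (d u == d v)].
  have uNv : u != v by apply: contraTneq uv => ->; rewrite adj_irrefl.
  pose u' : contract u v := Sub u uNv.
  pose q (x : H) : option (contract u v) := if x == v then Some u' else insub x.
  apply: (IH (contract u v) (fun x => d (val x))); [exact: small v|exact: minor_contract|].
  apply: (@branching_image H (contract u v) d _ q tirr _ _ _ brd).
  - move=> x i; rewrite /q; case: eqVneq => [->|xv] dx.
      by exists u' => //; rewrite SubK duv.
    by exists (Sub x xv); rewrite ?insubT ?SubK.
  - move=> y i dy; exists (val y) => //.
    by rewrite /q (negbTE (valP y)) valK.
  move=> x x' y y'; rewrite /q.
  have qE z w : (if z == v then Some u' else insub z) = Some w ->
      z = v /\ val w = u \/ z = val w.
    case: eqP => [-> [<-]|_]; first by left; rewrite SubK.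
    by case: insubP => // a _ <- [<-]; right.
  move=> /qE qx /qE qx' yy' xx'; rewrite /adj /= yy' /=.
  case: qx qx' xx' => [[-> ->]|->] [[-> ->]|->] xx'; rewrite ?eqxx ?xx' ?orbT //.
  - by rewrite adj_irrefl in xx'.
  - by rewrite adj_sym in xx'; rewrite xx' !orbT.
have dinj x y i : d x = Some i -> d y = Some i -> x = y.
  move=> dx dy; apply/eqP; apply: contraNT nouv => xy.
  have [_ conn _] := brd.
  have [||a [b [da db _ _ ab]]] := conn i [set x].
  - by exists x; rewrite ?set11.
  - by exists y; rewrite // in_set1 eq_sym.
  by apply/existsP; exists a; apply/existsP; exists b; rewrite ab da db eqxx.
have [surj _ touch] := brd.
have [h hP] := choice surj.
have /choice[g gP] : forall x, exists i, d x = Some i.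
  by move=> x; have := coloured x; case: (d x) => // i _; exists i.
exists H, h; split=> //.
  exists g => [i|x]; last exact: dinj (hP _) (gP x).
  by have := hP i; rewrite gP => -[].
move=> i j /touch[x [y [dx dy xy]]].
by rewrite (dinj _ _ _ (hP i) dx) (dinj _ _ _ (hP j) dy).
Qed.
End Minor.

(** * Isoperimetry of complete binary trees *)

Fact heap_parent_subproof N (i : 'I_N) : i.-1./2 < N.
Proof. by apply: leq_ltn_trans (ltn_ord i); lia. Qed.

(** Binary trees in heap order: the children of [v] are [2 v + 1] and
    [2 v + 2].  The root [0] becomes its own parent. *)
Definition heap_parent N (i : 'I_N) := Ordinal (heap_parent_subproof i).

Lemma heap_parent_lt N (i : 'I_N) : 0 < i -> heap_parent i < i.
Proof. by rewrite /=; lia. Qed.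

(** The number of nodes at or below [v] in the complete binary tree with [h]
    levels; it vanishes for [v] outside the tree, which makes the recursion uniform. *)
Definition subheap_size h v := (2 ^ (h - trunc_log 2 v.+1)).-1.

Lemma subheap_sizeE h v : v < (2 ^ h).-1 ->
  subheap_size h v = (subheap_size h v.*2.+1 + subheap_size h v.*2.+2).+1.
Proof.
move=> ltv; rewrite /subheap_size.
have logE b : trunc_log 2 ((b : bool) + v.*2.+2) = (trunc_log 2 v.+1).+1.
  rewrite trunc_log2S; last by lia.
  by rewrite -doubleS half_bit_double.
rewrite (logE false) (logE true).
have : trunc_log 2 v.+1 < h.
  by rewrite -(@ltn_exp2l 2) //; apply: leq_ltn_trans (trunc_logP _ _) _; lia.
move: (trunc_log _ _) => d ltd.
have -> : h - d = (h - d.+1).+1 by lia.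
have := expn_gt0 2 (h - d.+1); rewrite expnS.
lia.
Qed.

Lemma subheap_size_out h v : (2 ^ h).-1 <= v -> subheap_size h v = 0.
Proof.
move=> lev; rewrite /subheap_size.
suff /eqP-> : h - trunc_log 2 v.+1 == 0 by [].
by rewrite subn_eq0 trunc_log_max //; lia.
Qed.

(** Each node [u] contributes its subtree size, which is one more than what its
    two children contribute. *)
Lemma heap_sum_children h (a : nat -> nat) m : m <= (2 ^ h).-1 ->
  \sum_(0 <= u < m) a u + \sum_(1 <= v < m.*2.+1) subheap_size h v * a v.-1./2
  = \sum_(0 <= u < m) subheap_size h u * a u.
Proof.
elim: m => [|m IH] lem; first by rewrite double0 !big_geq.
rewrite doubleS !(big_nat_recr m.*2.+2) ?(big_nat_recr m.*2.+1) ?(big_nat_recr m) //=.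
rewrite -IH ?(ltnW lem) // (subheap_sizeE lem) uphalf_double doubleK.
by rewrite mulSn mulnDl; lia.
Qed.

Lemma heap_sum h (a : nat -> nat) :
  \sum_(0 <= u < (2 ^ h).-1) a u
    + \sum_(1 <= v < (2 ^ h).-1) subheap_size h v * a v.-1./2
  = \sum_(0 <= u < (2 ^ h).-1) subheap_size h u * a u.
Proof.
case: h => [|h]; first by rewrite !big_geq.
have N0 : 0 < (2 ^ h.+1).-1 by have := expn_gt0 2 h; rewrite expnS; lia.
rewrite -heap_sum_children //; congr (_ + _).
rewrite [RHS](@big_cat_nat _ _ _ (2 ^ h.+1).-1) //=; last by rewrite -addnn; lia.
rewrite [X in _ = _ + X]big_nat [X in _ = _ + X]big1 ?addn0 // => v /andP[lev _].
by rewrite subheap_size_out.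
Qed.

Local Open Scope ring_scope.

Lemma sum_pad (I : finType) (W : Type) (C : {set I}) (f : I -> W) (w0 : W)
    (F : W -> int) L : F w0 = 0 -> (#|C| <= L)%N ->
  exists t : 'I_L -> W, \sum_(i in C) F (f i) = \sum_k F (t k).
Proof.
move=> F0 leC; pose s := [seq f i | i <- enum C].
have szs : size s = #|C| by rewrite size_map -cardE.
exists (fun k => nth w0 s k).
rewrite -(big_mkord xpredT (fun k => F (nth w0 s k))).
rewrite (@big_cat_nat _ _ _ (size s)) ?szs //= [X in _ + X]big_nat [X in _ + X]big1 ?addr0.
  by rewrite -szs -(big_nth w0 xpredT F) big_map big_enum.
by move=> k /andP[lek _]; rewrite nth_default // szs.
Qed.

(** The exponent [0] gives the summand [0], so shorter sums are included. *)
Definition digit_sum h L (t : {ffun 'I_L -> 'I_h.+1 * bool}) : int :=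
  \sum_k (-1) ^+ (t k).2 * ((2 ^ (t k).1).-1)%:Z.

(** There are at most [(2 h + 2) ^ L] digit sums. *)
Lemma digit_sum_gap h L : ((h.+1).*2 ^ L < (2 ^ h).-1)%N ->
  exists2 i : nat, (0 < i <= (2 ^ h).-1)%N &
    forall t : {ffun 'I_L -> 'I_h.+1 * bool}, digit_sum t <> i%:Z.
Proof.
move=> few; pose vals := codom (@digit_sum h L).
have [/allP all|/allPn[i]] := boolP (all (fun i : nat => i%:Z \in vals) (iota 1 (2 ^ h).-1)).
  have uq : uniq (map Posz (iota 1 (2 ^ h).-1))
    by rewrite map_inj_uniq ?iota_uniq // => x y [].
  have : (size (map Posz (iota 1 (2 ^ h).-1)) <= size vals)%N.
    by apply: uniq_leq_size => // _ /mapP[i /all iv ->].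
  rewrite size_map size_iota size_codom card_ffun card_prod !card_ord card_bool muln2.
  by rewrite leqNgt few.
rewrite mem_iota add1n ltnS => iN; move/negP=> ni; exists i => // t eqt.
by apply: ni; rewrite -eqt codom_f.
Qed.

(** Abel summation along the tree: the size of [A] is the sum of the subtree
    sizes over the nodes that enter [A], minus the sum over those that leave it,
    when going down from the root. *)
Lemma heap_card_digit_sum h L (A : {set 'I_(2 ^ h).-1}) :
  (#|[set i | (i \in A) != ((0 < i)%N && (heap_parent i \in A))]| <= L)%N ->
  exists t : {ffun 'I_L -> 'I_h.+1 * bool}, digit_sum t = #|A|%:Z.
Proof.
set C := [set i | _] => leC.
pose a k := k \in [seq val i | i in A].
have aE (i : 'I_(2 ^ h).-1) : a i = (i \in A).
  by rewrite /a mem_map ?mem_enum //; apply: val_inj.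
have cardE : #|A|%:Z = \sum_(i < (2 ^ h).-1)
   (subheap_size h i)%:Z * ((i \in A)%:Z - ((0 < i)%N && (heap_parent i \in A))%:Z).
  have sumA : (\sum_(0 <= u < (2 ^ h).-1) a u = #|A|)%N.
    rewrite big_mkord -sum1_card [RHS]big_mkcond /=.
    by apply: eq_bigr => i _; rewrite aE; case: (_ \in _).
  have sumP : (\sum_(1 <= v < (2 ^ h).-1) subheap_size h v * a v.-1./2 =
      \sum_(i < (2 ^ h).-1) subheap_size h i * ((0 < i) && (heap_parent i \in A)))%N.
    transitivity (\sum_(i < (2 ^ h).-1) subheap_size h i * ((0 < i) && a i.-1./2))%N; last first.
      by apply: eq_bigr => i _; rewrite -aE.
    rewrite -(big_mkord xpredT (fun v => subheap_size h v * ((0 < v) && a v.-1./2))%N).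
    case: (posnP (2 ^ h).-1) => [->|N0]; first by rewrite !big_geq.
    rewrite [RHS]big_ltn //= muln0 add0n.
    by apply: eq_big_nat => v /andP[-> _].
  have := heap_sum h a; rewrite sumA sumP big_mkord => /(congr1 Posz).
  rewrite PoszD !(big_morph Posz PoszD (erefl _)).
  move/(canRL (addrK _)) => ->; rewrite -sumrB.
  by apply: eq_bigr => i _; rewrite aE !PoszM mulrBr.
pose f (i : 'I_(2 ^ h).-1) : 'I_h.+1 * bool :=
  (inord (h - trunc_log 2 i.+1), i \notin A).
pose F (w : 'I_h.+1 * bool) : int := (-1) ^+ w.2 * ((2 ^ w.1).-1)%:Z.
have [t tE] := @sum_pad _ _ C f (ord0, false) F L (mulr0 _) leC.
exists (finfun t); rewrite cardE /digit_sum.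
under eq_bigr do rewrite ffunE.
rewrite -/(F _) -tE [RHS](bigID (mem C)) /= [X in _ = _ + X]big1 ?addr0.
  apply: eq_bigr => i; rewrite inE /F /f /= inordK ?ltnS ?leq_subr //.
  rewrite mulrC /subheap_size; case: (i \in A); case: (_ && _) => //= _.
by move=> i; rewrite inE negbK => /eqP ->; rewrite subrr mulr0.
Qed.

Local Close Scope ring_scope.

(** A change of membership is at the root, at a node of [B], or just below a node
    of [B], and every node has at most two children. *)
Lemma card_heap_change N (A B : {set 'I_N}) :
  (forall i : 'I_N, 0 < i -> (i \in A) != (heap_parent i \in A) ->
    i \in B \/ heap_parent i \in B) ->
  #|[set i : 'I_N | (i \in A) != ((0 < i) && (heap_parent i \in A))]| <= (3 * #|B|).+1.
Proof.
move=> change.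
pose Z := [set i : 'I_N | i == 0 :> nat].
pose K := [set i : 'I_N | 0 < i & heap_parent i \in B].
have leZ : #|Z| <= 1.
  by apply/card_le1_eqP => i j; rewrite !inE => /eqP i0 /eqP j0; apply: val_inj; rewrite /= i0.
have leK : #|K| <= 2 * #|B|.
  pose g (i : 'I_N) := (heap_parent i, odd i).
  rewrite -(card_in_imset (f := g)); last first.
    move=> i j; rewrite !inE => /andP[i0 _] /andP[j0 _] [eqh eqo]; apply: val_inj => /=.
    by move: eqh eqo i0 j0; clear; lia.
  rewrite mulnC -[2]card_bool -cardsT -cardsX subset_leq_card //.
  by apply/subsetP => _ /imsetP[i iK ->]; rewrite !inE; move: iK; rewrite inE => /andP[_ ->].
have sub : [set i : 'I_N | (i \in A) != ((0 < i) && (heap_parent i \in A))] \subset Z :|: B :|: K.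
  apply/subsetP => i; rewrite inE !in_setU => ch.
  have [i0|i0] := posnP i; first by rewrite [i \in Z]inE (introT eqP i0).
  rewrite [i \in K]inE i0 /=.
  by case: (change i i0 _) => [|->|->]; rewrite ?orbT //; move: ch; rewrite i0.
apply: leq_trans (subset_leq_card sub) _.
apply: leq_trans (leq_card_setU _ _) _.
apply: leq_trans (leq_add (leq_trans (leq_card_setU _ _) (leq_add leZ (leqnn _))) leK) _.
by move: #|B|; clear; lia.
Qed.

Lemma exp_beats_poly L : exists2 h, h.+1.*2 ^ L < (2 ^ h).-1 & L < (2 ^ h).-1.
Proof.
have gap t : (t.+2 * L).+2 <= 2 ^ t -> (2 ^ t).+1.*2 ^ L < (2 ^ (2 ^ t)).-1.
  move=> le_t; have le_base : (2 ^ t).+1.*2 <= 2 ^ t.+2.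
    by rewrite !expnS; have := expn_gt0 2 t; move: (2 ^ t); clear; lia.
  have le_pow : (2 ^ t).+1.*2 ^ L <= 2 ^ (t.+2 * L).
    by rewrite expnM; case: (posnP L) => [->|L0]; rewrite ?expn0 ?leq_exp2r.
  have : 2 ^ (t.+2 * L).+2 <= 2 ^ (2 ^ t) by rewrite leq_exp2l.
  have : 0 < 2 ^ (t.+2 * L) by rewrite expn_gt0.
  rewrite (expnS 2 (_ * _).+1) (expnS 2 (_ * _)).
  move: le_pow; move: (_ ^ L) (2 ^ (_ * _)) (2 ^ (2 ^ t)); clear; lia.
(* Any exponent [t] with [(t + 2) L + 2 <= 2 ^ t] will do. *)
pose t := (L.+2).*2.
have /gap pow_lt : (t.+2 * L).+2 <= 2 ^ t.
  have : L < 2 ^ L by apply: ltn_expl.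
  have -> : 2 ^ t = 16 * (2 ^ L * 2 ^ L).
    by rewrite -expnD addnn /t !doubleS !expnS !mulnA.
  rewrite /t; move: (2 ^ L) => q; clear; nia.
exists (2 ^ t) => //; apply: leq_ltn_trans pow_lt.
by apply: ltnW; apply: ltn_expl; rewrite doubleS.
Qed.

(** If a set of a size that is not a digit sum had fewer than [M] boundary
    vertices, its membership would change at no more than [3 M + 1] nodes. *)
Lemma heap_peak M : exists N, forall (G : sgraph) (f : 'I_N -> G), bijective f ->
  (forall i : 'I_N, 0 < i -> adj (f i) (f (heap_parent i))) -> M <= viso_peak G.
Proof.
have [h few ltL] := exp_beats_poly (3 * M).+1.
have [i iN gap] := digit_sum_gap few.
exists (2 ^ h).-1 => G f bijf edge.
have cardG : #|G| = (2 ^ h).-1 by rewrite -(bij_eq_card bijf) card_ord.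
have peak_ge : viso_at G i <= viso_peak G.
  rewrite /viso_peak; apply: (leq_bigmax_seq (F := viso_at G)) => //.
  by rewrite mem_index_iota cardG ltnS.
apply: leq_trans peak_ge; rewrite /viso_at.
elim/big_ind: _ => [|p q pM qM|S /eqP cardS]; first by rewrite cardG; lia.
  by rewrite leq_min pM.
rewrite leqNgt; apply/negP => ltM.
pose A := f @^-1: S; pose B := f @^-1: boundary S.
have card_pre (S' : {set G}) : #|f @^-1: S'| = #|S'|.
  by apply: on_card_preimset; apply: onW_bij.
have [|t] := @heap_card_digit_sum h (3 * M).+1 A; last by rewrite card_pre cardS; apply: gap.
apply: leq_trans (card_heap_change (B := B) _) _; last first.
  by rewrite card_pre; lia.
move=> j j0; rewrite !inE; case jS: (f j \in S); case pS: (f (heap_parent j) \in S) => //= _.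
  by right; apply/existsP; exists (f j); rewrite jS edge.
by left; apply/existsP; exists (f (heap_parent j)); rewrite pS adj_sym edge.
Qed.

(** * The growth function *)

Lemma pathwidth_peak M : exists K, forall G : sgraph, K <= pathwidth G ->
  exists2 H : sgraph, minor G H & M <= viso_peak H.
Proof.
have [N peak] := heap_peak M; exists N.+1 => G pwG.
have [c [surj conn touch]] := tree_model (@heap_parent_lt N) pwG.
pose t : rel 'I_N := fun i j => (0 < i) && (j == heap_parent i).
have [||H [f [GH bijf edge]]] := @branching_minor _ t G c.
- move=> i; rewrite /t; apply/negP => /andP[i0 /eqP ii].
  by have := heap_parent_lt i0; rewrite -ii ltnn.
- by split=> // i j /andP[i0 /eqP->]; apply: touch.
by exists H => //; apply: (peak H f) => // i i0; apply: edge; rewrite /t i0 eqxx.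
Qed.

Local Open Scope ring_scope.

Theorem theorem2 (R : realType) :
  exists f : nat -> R,
    [/\ {homo f : m n / (m < n)%N >-> m < n},
        (forall M : R, exists k : nat, M < f k) &
        forall (G : sgraph) (k : nat), (k <= pathwidth G)%N ->
          exists2 G' : sgraph, minor G G' & f k <= (viso_peak G')%:R].
Proof.
have [K KP] := choice pathwidth_peak.
(* The bound [M <= k] only keeps the maximum finite. *)
pose g k := (\max_(M < k.+1 | (K M <= k)%N) M)%N.
have g_ge k M : (M <= k)%N -> (K M <= k)%N -> (M <= g k)%N.
  by rewrite -ltnS => Mk KM; apply: (leq_bigmax_cond (Ordinal Mk)).
have g_mono m n : (m <= n)%N -> (g m <= g n)%N.
  move=> mn; apply/bigmax_leqP => M KM; apply: g_ge; last exact: leq_trans KM mn.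
  by apply: leq_trans mn; rewrite -ltnS.
(* [g] is only nondecreasing; the second term makes the function strictly
   increasing without exceeding [g]. *)
exists (fun k => (g k)%:R - k.+1%:R^-1); split=> [m n mn|x|G k pwG].
- rewrite ler_ltD ?ler_nat ?g_mono ?(ltnW mn) // ltrN2 ltf_pV2 ?posrE ?ltr0n // ltr_nat.
  by rewrite ltnS.
- have [M ltM] : exists M : nat, x + 1 < M%:R.
    exists (Num.bound `|x + 1|); apply: le_lt_trans (ler_norm _) _.
    by rewrite archi_boundP ?normr_ge0.
  exists (maxn M (K M)); have := g_ge (maxn M (K M)) M.
  rewrite leq_maxl leq_maxr => /(_ isT isT); rewrite -(ler_nat R) => leM.
  have le1 : (maxn M (K M)).+1%:R^-1 <= 1 :> R by rewrite invf_le1 ?ltr0n // ler1n.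
  apply: lt_le_trans (_ : M%:R - 1 <= _); first by rewrite ltrBrDr.
  exact: lerB.
have : exists2 H : sgraph, minor G H & (g k <= viso_peak H)%N.
  rewrite /g; elim/big_ind: _ => [|p q pk qk|M KM].
  - by exists G => //; apply: minor_refl.
  - by case: (leqP p q) => _.
  - by apply: KP; apply: leq_trans pwG.
case=> H GH gH; exists H => //.
rewrite lerBlDr; apply: ler_wpDr; first by rewrite invr_ge0 ler0n.
by rewrite ler_nat.
Qed.
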